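(* Let $\lambda\in\mathbb{R}$ and let $k\ge 1$ be an integer. For every integer $n\ge 0$, $$\widehat{D}_{n,\lambda}^{(k)}=\frac{1}{n+1}\sum_{m=1}^{n+1}\frac{\lambda^{m-1}}{m^{k-1}}S_{1}(n+1,m).$$
   Context: The multiple degenerate Daehee numbers $\widehat{D}_{n,\lambda}^{(k)}$ ($n\ge 0$) are defined by the $k$-fold integral over the unit cube $$\frac{\log(1+t)}{t}\int_{0}^{1}\cdots\int_{0}^{1}(1+t)^{\lambda x_{1}x_{2}\cdots x_{k}}\,dx_{1}dx_{2}\cdots dx_{k}=\sum_{n=0}^{\infty}\widehat{D}_{n,\lambda}^{(k)}\frac{t^{n}}{n!},$$ as a power series in $t$ (for $|t|$ small). The (signed) Stirling numbers of the first kind $S_1(n,l)$ are defined by $(x)_n=\sum_{l=0}^n S_1(n,l)x^l$ for $n\ge 0$, where $(x)_0=1$ and $(x)_n=x(x-1)\cdots(x-n+1)$ for $n\ge 1$. Convention: $0^0=1$. *)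

(* Defs.v *)
From HB Require Import structures.
From mathcomp Require Import all_boot all_order all_algebra.
From mathcomp Require Import all_classical all_reals all_analysis.

Set Implicit Arguments.
Unset Strict Implicit.
Unset Printing Implicit Defensive.

Import Order.TTheory GRing.Theory Num.Theory.
Import numFieldNormedType.Exports.

Local Open Scope classical_set_scope.
Local Open Scope ring_scope.

(* The falling factorial (X)_n = X (X - 1) ... (X - n + 1) as a polynomial. *)
Definition falling_poly (R : realType) (n : nat) : {poly R} :=
  \prod_(i < n) ('X - (i%:R)%:P).

Definition stirling1 (R : realType) (n l : nat) : R := (falling_poly R n)`_l.

(* cube_integral f = \int_0^1 ... \int_0^1 f(x_1, ..., x_k) dx_1 ... dx_k,
   with dx_1 innermost: the outermost variable is the last entry. *)
Fixpoint cube_integral (R : realType) (k : nat) : (k.-tuple R -> R) -> R :=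
  match k return (k.-tuple R -> R) -> R with
  | 0 => fun f => f [tuple]
  | k'.+1 => fun f =>
      \int[lebesgue_measure]_(x in `[0, 1])
        cube_integral (fun s : k'.-tuple R => f [tuple of rcons s x])
  end.

(* The quotient by t makes the left-hand side of the generating identity
   undefined at t = 0, whence the punctured neighbourhood 0^'. *)
Definition daehee_gf (R : realType) (lambda : R) (k : nat) (D : nat -> R) :
    Prop :=
  \forall t \near (0 : R)^',
    series (fun n => D n * (t ^+ n / n`!%:R)) @ \oo -->
      ln (1 + t) / t *
      cube_integral (fun x : k.-tuple R =>
        (1 + t) `^ (lambda * \prod_(i < k) tnth x i)).

(* xget picks a sequence satisfying daehee_gf if there is one and returns the
   dummy value 0 otherwise. *)
Definition daehee (R : realType) (lambda : R) (k n : nat) : R :=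
  xget (fun _ : nat => 0 : R) [set D | daehee_gf lambda k D] n.

(* Main.v *)
Require Import Defs.
From HB Require Import structures.
From mathcomp Require Import all_boot all_order all_algebra.
From mathcomp Require Import all_classical all_reals all_analysis.
From mathcomp Require Import ring lra.
Import Order.TTheory GRing.Theory Num.Theory.
Import numFieldNormedType.Exports.

(** Write [L = ln (1 + t)] and let [mean] send [f] to the function
    [a |-> \int_0^1 f (a * x) dx]. Integrating one variable at a time, the cube
    integral of [g (a * x_1 * ... * x_k)] is the [k]-th iterate of [mean]
    applied to [g] (lemma [cube_integral_prod]). Here
    [g a = (1 + t) `^ a = expR (a * L)], and one application of [mean] absorbs
    the factor [L] of the generating function:
    [L * mean g a = expint a L], which is [((1 + t) `^ a - 1) / a], or [L] if
    [a = 0].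

    By the binomial theorem this function of [a] is the sum over [n] of
    [q_n(a) * t ^+ n.+1 / n.+1`!], where
    [q_n = ('X - 1) * ... * ('X - n)] is the falling factorial of order [n.+1]
    divided by ['X]: its coefficients are the Stirling numbers [S_1(n + 1, m)]
    with [m] shifted by one. The series converges geometrically, uniformly for
    [a] in a bounded interval, as soon as [t] is small
    (lemma [newton_partial_bound]). Since [mean] integrates over a probability
    measure and only evaluates [f] between [0] and [a], it preserves uniform
    approximation by polynomials on [[-A, A]], with the same error bound
    (lemma [mean_approx]); and on polynomials it divides the coefficient of
    ['X^i] by [i + 1]. Hence the remaining [k - 1] integrations may be done
    term by term, and they divide the coefficient [S_1(n + 1, m)] by
    [m ^ (k - 1)]. Evaluating at [lambda] gives an explicit sequence which
    satisfies the generating identity (lemma [daehee_gf_mean_poly]).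

    The sequence [daehee] is only specified as some sequence satisfying that
    identity, so it must also be known that a power series which vanishes on a
    punctured neighbourhood of 0 has zero coefficients (lemma
    [pseries_eq0]). *)

Local Open Scope classical_set_scope.
Local Open Scope ring_scope.

(** * Falling factorials divided by the variable *)

Definition shifted_falling (R : realType) (n : nat) : {poly R} :=
  \prod_(i < n) ('X - (i.+1%:R)%:P).

Lemma falling_polyS {R : realType} n :
  falling_poly R n.+1 = 'X * shifted_falling R n.
Proof. by rewrite /falling_poly big_ord_recl polyC0 subr0. Qed.

Lemma size_shifted_falling (R : realType) n : size (shifted_falling R n) = n.+1.
Proof.
rewrite /shifted_falling (size_prod_XsubC _ (fun i : 'I_n => i.+1%:R)).
by rewrite /index_enum -enumT size_enum_ord.
Qed.

Lemma horner_shifted_fallingS {R : realType} n (a : R) :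
  (shifted_falling R n.+1).[a] = (a - n.+1%:R) * (shifted_falling R n).[a].
Proof. by rewrite /shifted_falling big_ord_recr /= hornerM !hornerE mulrC. Qed.

(** Each factor satisfies [`|a - (i + 1)| <= (A + 1) * (i + 1)], so the
    factorials in the series below cancel and leave a geometric series. *)
Lemma shifted_falling_bound {R : realType} (a A : R) n : `|a| <= A ->
  `|(shifted_falling R n).[a]| <= (A + 1) ^+ n * n`!%:R.
Proof.
move=> aA; elim: n => [|n IH].
  by rewrite /shifted_falling big_ord0 hornerC normr1 expr0 mul1r.
have A0 : 0 <= A := le_trans (normr_ge0 a) aA.
rewrite horner_shifted_fallingS normrM exprS factS natrM mulrACA.
apply: ler_pM => //; rewrite (le_trans (ler_normB _ _))// normr_nat.
have : 0 <= n%:R :> R by [].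
rewrite -[n.+1%:R]natr1; nra.
Qed.

(** * The binomial series with a uniform remainder estimate *)

(** This is [\int_0^y expR (a * s) ds] in closed form. Treating [a = 0] apart
    here keeps the case split out of every later argument, which goes through
    [expintE] and [is_derive_expint] only. *)
Definition expint {R : realType} (a y : R) : R :=
  if a == 0 then y else (expR (a * y) - 1) / a.

Lemma expint0 {R : realType} (a : R) : expint a 0 = 0.
Proof. by rewrite /expint; case: eqP => // _; rewrite mulr0 expR0 subrr mul0r. Qed.

Lemma expintE {R : realType} (a y : R) : 1 + a * expint a y = expR (a * y).
Proof.
rewrite /expint; case: eqP => [->|/eqP a0]; first by rewrite !mul0r expR0 addr0.
by field.
Qed.

Lemma is_derive_expRM {R : realType} (a y : R) :
  is_derive y (1:R) (fun y => expR (a * y)) (a * expR (a * y)).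
Proof. by apply: is_derive_eq; rewrite /GRing.scale /=; ring. Qed.

Lemma is_derive_expint {R : realType} (a y : R) :
  is_derive y (1:R) (expint a) (expR (a * y)).
Proof.
have [a0|a0] := eqVneq a 0.
  rewrite a0 mul0r expR0 (_ : expint 0 = id); first exact: is_derive_id.
  by apply/funext => z; rewrite /expint eqxx.
rewrite (_ : expint a = fun z => (expR (a * z) - 1) * a^-1); last first.
  by apply/funext => z; rewrite /expint (negbTE a0).
have H := is_derive_expRM a y.
by apply: is_derive_eq; rewrite /GRing.scale /=; field.
Qed.

(** Partial sums of the binomial series of [((1 + t) `^ a - 1) / a], as
    polynomials in [t]. *)
Definition newton_partial {R : realType} (a : R) (N : nat) : {poly R} :=
  \sum_(n < N) ((shifted_falling R n).[a] / n.+1`!%:R) *: 'X^(n.+1).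

(** The function [h = ((1 + s) `^ a - 1) / a] solves
    [(1 + s) * h' = 1 + a * h]. Its partial sums solve the same equation up to
    one explicit term, because the sums telescope through
    [q_(n+1)(a) = (a - (n + 1)) * q_n(a)]. *)
Lemma newton_partial_ode {R : realType} (a s : R) N :
  (1 + s) * (newton_partial a N)^`().[s] =
  1 + a * (newton_partial a N).[s] - (shifted_falling R N).[a] * s ^+ N / N`!%:R.
Proof.
elim: N => [|N IH].
  rewrite /newton_partial /shifted_falling !big_ord0 deriv0 horner0 hornerC.
  by rewrite fact0 expr0; field.
rewrite /newton_partial big_ord_recr /= -/(newton_partial a N) derivD !hornerD.
rewrite mulrDr IH.
rewrite horner_shifted_fallingS derivZ derivXn !hornerZ hornerMn !hornerXn /=.
rewrite factS natrM exprS -mulr_natr.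
have f0 : N`!%:R != 0 :> R by rewrite pnatr_eq0 -lt0n fact_gt0.
have n0 : N%:R + 1 != 0 :> R by rewrite natr1 pnatr_eq0.
rewrite -natr1; field; by rewrite f0 n0.
Qed.

(** The difference of the partial sum and [expint a (ln (1 + s))] solves the
    linear equation [(1 + s) * u' = a * u - c s^N]; the integrating factor
    [(1 + s) `^ (- a)] removes the term [a * u]. *)
Lemma is_derive_remainder {R : realType} (a s : R) N : 0 < 1 + s ->
  is_derive s (1:R)
    (fun s => ((newton_partial a N).[s] - expint a (ln (1 + s))) *
              expR (- a * ln (1 + s)))
    (- (expR (- a * ln (1 + s)) / (1 + s) *
        ((shifted_falling R N).[a] * s ^+ N / N`!%:R))).
Proof.
move=> s0.
have dln : is_derive s (1:R) (fun s => ln (1 + s)) (1 + s)^-1.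
  have H := is_derive1_ln s0.
  have G : is_derive s (1:R) (fun s => 1 + s) 1.
    by apply: is_derive_eq; rewrite add0r mulr1.
  by have := @is_derive1_comp _ (@ln R) (fun s => 1 + s) s _ _ H G; rewrite mulr1.
have dE : is_derive s (1:R) (fun s => expint a (ln (1 + s)))
    (expR (a * ln (1 + s)) * (1 + s)^-1).
  have H := is_derive_expint a (ln (1 + s)).
  exact: (@is_derive1_comp _ (expint a) (fun s => ln (1 + s)) s _ _ H dln).
have dX : is_derive s (1:R) (fun s => expR (- a * ln (1 + s)))
    (- a * expR (- a * ln (1 + s)) * (1 + s)^-1).
  have H := is_derive_expRM (- a) (ln (1 + s)).
  exact: (@is_derive1_comp _ (fun y => expR (- a * y))
            (fun s => ln (1 + s)) s _ _ H dln).
apply: is_derive_eq.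
rewrite /GRing.scale /=.
have ode := newton_partial_ode a s N.
rewrite -expintE.
set c := _ / N`!%:R in ode *.
set h' := _^`().[s] in ode *.
have s1 : 1 + s != 0 by rewrite gt_eqF.
have -> : h' = (1 + a * (newton_partial a N).[s] - c) / (1 + s).
  by rewrite -ode; field.
by field.
Qed.

Lemma le_norm_ln_segment {R : realType} (t c : R) : `|t| < 1 -> 0 <= c <= 1 ->
  `|ln (1 + t * c)| <= `|ln (1 + t)|.
Proof.
rewrite ltr_norml => /andP[t1 t2] /andP[c0 c1].
have p1 : 0 < 1 + t by lra.
have p2 : 0 < 1 + t * c by nra.
have [t0|t0] := leP 0 t.
  have l1 : 0 <= ln (1 + t * c) by apply: ln_ge0; nra.
  have l2 : ln (1 + t * c) <= ln (1 + t) by rewrite ler_ln ?posrE//; nra.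
  by rewrite !ger0_norm// (le_trans l1 l2).
have l1 : ln (1 + t * c) <= 0 by apply: ln_le0; nra.
have l2 : ln (1 + t) <= ln (1 + t * c) by rewrite ler_ln ?posrE//; nra.
by rewrite !ler0_norm ?lerN2// (le_trans l2 l1).
Qed.

(** The mean value theorem on the segment from [0] to [t], applied to the
    remainder multiplied by [(1 + s) `^ (- a)]. The bound depends on [a]
    through [A] only, which is the uniformity that the integrations over the
    cube rely on. *)
Lemma newton_partial_bound {R : realType} (a A t : R) N : `|a| <= A -> `|t| < 1 ->
  `|expint a (ln (1 + t)) - (newton_partial a N).[t]| <=
  expR (A * `|ln (1 + t)|) ^+ 2 * (`|t| / (1 - `|t|)) * ((A + 1) * `|t|) ^+ N.
Proof.
move=> aA t1.
have A0 : 0 <= A := le_trans (normr_ge0 a) aA.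
have q0 : 0 < 1 - `|t| by rewrite subr_gt0.
pose v s := ((newton_partial a N).[s] - expint a (ln (1 + s))) *
  expR (- a * ln (1 + s)).
pose v' s := - (expR (- a * ln (1 + s)) / (1 + s) *
   ((shifted_falling R N).[a] * s ^+ N / N`!%:R)).
have tc_ge (c : R) : 0 <= c <= 1 -> 1 - `|t| <= 1 + t * c.
  move=> /andP[c0 c1]; have := lerNnormlW (lexx `|t|); have := ler_norm t.
  have := normr_ge0 t; move: (`|t|) => u; nra.
have dv (c : R) : 0 <= c <= 1 -> is_derive c (1:R) (fun x => v (t * x)) (v' (t * c) * t).
  move=> c01.
  have H := is_derive_remainder a (t * c) N (lt_le_trans q0 (tc_ge c c01)).
  have G : is_derive c (1:R) (fun x => t * x) t.
    by apply: is_derive_eq; rewrite /GRing.scale /=; ring.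
  exact: (@is_derive1_comp _ v (fun x => t * x) c _ _ H G).
(* Parametrising the segment by [0, 1] treats both signs of [t] at once. *)
have [||c] := @MVT_segment R (fun x => v (t * x))
  (fun c => v' (t * c) * t) 0 1 ler01.
- move=> x; rewrite in_itv /= => /andP[x0 x1]; apply: dv; lra.
- apply: derivable_within_continuous => x; rewrite in_itv /= => x01.
  exact: (@ex_derive _ _ _ _ _ _ _ (dv x x01)).
rewrite in_itv /= => c01; rewrite mulr1 mulr0 subr0 mulr1.
have -> : v 0 = 0.
  rewrite /v addr0 ln1 expint0 subr0 /newton_partial horner_sum.
  rewrite big1 ?mul0r// => i _; by rewrite hornerZ hornerXn expr0n mulr0.
rewrite subr0 => vt.
have expB b y : `|b| <= A -> `|y| <= `|ln (1 + t)| ->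
    expR (b * y) <= expR (A * `|ln (1 + t)|).
  by move=> bA yL; rewrite ler_expR (le_trans (ler_norm _))// normrM ler_pM.
have -> : expint a (ln (1 + t)) - (newton_partial a N).[t] =
    - (v t * expR (a * ln (1 + t))).
  by rewrite /v -mulrA -expRD mulNr addNr expR0 mulr1 opprB.
rewrite normrN vt !normrM normrN !normrM !normfV normr_nat.
rewrite [`|expR (a * _)|]ger0_norm ?expR_ge0// [`|expR _|]ger0_norm ?expR_ge0//.
have p1 := tc_ge _ c01.
rewrite [`|1 + _|]gtr0_norm; last exact: lt_le_trans p1.
set E := expR (A * _).
have e1 : expR (- a * ln (1 + t * c)) <= E.
  by apply: expB; rewrite ?normrN//; exact: le_norm_ln_segment.
have e2 : expR (a * ln (1 + t)) <= E by exact: expB.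
have e3 : (1 + t * c)^-1 <= (1 - `|t|)^-1.
  by rewrite lef_pV2// posrE (lt_le_trans q0).
have e4 : `|(shifted_falling R N).[a]| * `|(t * c) ^+ N| / N`!%:R <=
    ((A + 1) * `|t|) ^+ N.
  rewrite ler_pdivrMr ?ltr0n ?fact_gt0// [in leRHS]exprMn [leRHS]mulrAC.
  apply: ler_pM => //; first exact: shifted_falling_bound.
  rewrite normrX lerXn2r// ?nnegrE// normrM ler_piMr//.
  by move: c01 => /andP[c0 c1]; rewrite ger0_norm.
have F0 : 0 <= `|(shifted_falling R N).[a]| * `|(t * c) ^+ N| / N`!%:R.
  by rewrite !mulr_ge0// invr_ge0.
have i0 : 0 <= (1 + t * c)^-1 by rewrite invr_ge0 ltW// (lt_le_trans q0).
have E0 : 0 <= E by exact: expR_ge0.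
(* The factors of the bound in the order of those of the left-hand side. *)
rewrite [leRHS](_ : _ = E / (1 - `|t|) * ((A + 1) * `|t|) ^+ N * `|t| * E);
  last by ring.
apply: ler_pM => //.
- by rewrite !mulr_ge0 ?expR_ge0 //.
apply: ler_wpM2r => //; apply: ler_pM => //.
  by rewrite mulr_ge0 ?expR_ge0.
by apply: ler_pM => //; exact: expR_ge0.
Qed.

(** * Uniqueness of power series coefficients *)

(** Convergence at one point [r / 2] bounds [d n * (r / 2) ^+ n] by a constant
    [M]; at the point [r / 2 * s] the terms beyond the first then add up to at
    most [2 * M * s], which is arbitrarily small, while the whole sum is 0. *)
Lemma pseries_coef0_eq0 {R : realType} (d : nat -> R) :
  (\forall t \near (0 : R)^',
     series (fun n => d n * t ^+ n) @ \oo --> (0:R)) ->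
  d 0%N = 0.
Proof.
move=> [/= r r0 Hr].
have r2 : 0 < r / 2 by lra.
have conv s : 0 < s <= 1 -> series (fun n => d n * (r / 2 * s) ^+ n) @ \oo --> (0:R).
  move=> /andP[s0 s1]; apply: Hr => /=; last by nra.
  rewrite /ball /= sub0r normrN gtr0_norm; nra.
have [K [_ HK]] : bounded_fun (fun n => d n * (r / 2) ^+ n).
  apply: cvg_series_bounded; apply/cvg_ex; exists 0.
  by have := conv 1; rewrite mulr1 ltr01 lexx; apply.
pose M := `|K| + 1.
have M0 : 0 < M by rewrite ltr_wpDl.
have HM n : `|d n * (r / 2) ^+ n| <= M.
  by apply: HK => //; rewrite ltr_pwDr// ler_norm.
suff key s : 0 < s <= 1 / 2 -> `|d 0%N| <= 2 * M * s.
  apply/eqP; rewrite -normr_eq0; apply/eqP/le_anti; rewrite normr_ge0 andbT.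
  rewrite leNgt; apply/negP => D0.
  pose s := Num.min (1 / 2) (`|d 0%N| / (4 * M)).
  have s0 : 0 < s by rewrite lt_min divr_gt0 ?divr_gt0// mulr_gt0.
  have := key s; rewrite s0 ge_min lexx /= => /(_ isT).
  have : s <= `|d 0%N| / (4 * M) by rewrite ge_min lexx orbT.
  rewrite ler_pdivlMr ?mulr_gt0//; nra.
move=> /andP[s0 s2].
pose S := series (fun n => d n * (r / 2 * s) ^+ n).
have c1 : S @ \oo --> (0:R) by apply: conv; lra.
have tail N : `|d 0%N - S N.+1| <= 2 * M * s.
  rewrite /S /series /= big_nat_recl//= expr0 mulr1 opprD addrA subrr sub0r normrN.
  (* The sharper bound is the partial geometric sum, as needed by induction. *)
  apply: le_trans (_ : M * s * (2 - 2 * (1 / 2) ^+ N) <= _); last first.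
    have : 0 <= (1 / 2 : R) ^+ N by rewrite exprn_ge0.
    have b0 : 0 < M * s by rewrite mulr_gt0.
    rewrite mulrBr lerBlDr (_ : 2 * M * s = M * s * 2); last ring.
    by rewrite lerDl !mulr_ge0// ltW.
  elim: N => [|N IH]; first by rewrite big_geq// normr0 expr0; nra.
  rewrite big_nat_recr//= (le_trans (ler_normD _ _))//.
  have b : `|d N.+1 * (r / 2 * s) ^+ N.+1| <= M * s * (1 / 2) ^+ N.
    rewrite exprMn mulrA normrM [in leRHS]mulrAC -mulrA ler_pM//.
    rewrite normrX gtr0_norm// exprSr; apply: ler_wpM2r; first exact: ltW.
    by rewrite lerXn2r// nnegrE; lra.
  by apply: le_trans (lerD IH b) _; rewrite exprS; nra.
have : (fun N => `|d 0%N - S N.+1|) @ \oo --> `|d 0%N - 0|.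
  by apply: cvg_norm; apply: cvgB; [exact: cvg_cst|rewrite cvg_shiftS].
by rewrite subr0 => c2; apply: (ler_cvg_to c2 (cvg_cst _)); exact: nearW.
Qed.

(** Once the constant coefficient is known to vanish, dividing by [t] yields a
    series of the same kind; this is why the hypothesis leaves out [t = 0]. *)
Lemma pseries_eq0 {R : realType} (d : nat -> R) :
  (\forall t \near (0 : R)^',
     series (fun n => d n * t ^+ n) @ \oo --> (0:R)) ->
  forall n, d n = 0.
Proof.
move=> H n; elim: n d H => [|n IH] d H; first exact: pseries_coef0_eq0.
apply: (IH (fun m => d m.+1)).
have d0 := pseries_coef0_eq0 d H.
have tn0 : \forall t \near (0 : R)^', t != 0 by exact: nbhs_dnbhs_neq.
near=> t.
have t0 : t != 0 by near: t.
have Ht : series (fun n => d n * t ^+ n) @ \oo --> (0:R) by near: t.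
rewrite (_ : series _ =
    fun N => t^-1 * series (fun n => d n * t ^+ n) N.+1); last first.
  apply/funext => N; rewrite /series /= big_nat_recl//= d0 mul0r add0r.
  rewrite mulr_sumr.
  by apply: eq_bigr => i _; rewrite exprS; field.
rewrite -(mulr0 t^-1); apply: cvgMr; rewrite cvg_shiftS; exact: Ht.
Unshelve. all: by end_near.
Qed.

(** * Averaging over the unit interval *)

Definition mean {R : realType} (f : R -> R) (a : R) : R :=
  \int[lebesgue_measure]_(x in `[0, 1]) f (a * x).

(** The effect on polynomials of applying [mean] [k] times; see
    [mean_horner] for [k = 1]. *)
Definition mean_poly {R : realType} (k : nat) (p : {poly R}) : {poly R} :=
  \poly_(i < size p) (p`_i / i.+1%:R ^+ k).

Lemma coef_mean_poly {R : realType} k (p : {poly R}) i :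
  (mean_poly k p)`_i = p`_i / i.+1%:R ^+ k.
Proof.
by rewrite coef_poly; case: ltnP => // /(nth_default 0) ->; rewrite mul0r.
Qed.

Lemma mean_polyZ {R : realType} k (c : R) p :
  mean_poly k (c *: p) = c *: mean_poly k p.
Proof. by apply/polyP => i; rewrite coefZ !coef_mean_poly coefZ mulrA. Qed.

Lemma mean_poly_sum {R : realType} k N (F : 'I_N -> {poly R}) :
  mean_poly k (\sum_(n < N) F n) = \sum_(n < N) mean_poly k (F n).
Proof.
apply/polyP => i; rewrite coef_mean_poly !coef_sum mulr_suml.
by apply: eq_bigr => n _; rewrite coef_mean_poly.
Qed.

Lemma mean_poly0 {R : realType} (p : {poly R}) : mean_poly 0 p = p.
Proof. by apply/polyP => i; rewrite coef_mean_poly expr0 divr1. Qed.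

Lemma mean_polyS {R : realType} k (p : {poly R}) :
  mean_poly k.+1 p = mean_poly 1 (mean_poly k p).
Proof.
apply/polyP => i; rewrite !coef_mean_poly expr1 exprSr invfM.
by rewrite mulrA.
Qed.

Lemma Rintegral01_FTC2 {R : realType} (F f : R -> R) :
  (forall x, is_derive x (1:R) F (f x)) -> continuous f ->
  \int[lebesgue_measure]_(x in `[0, 1]) f x = F 1 - F 0.
Proof.
move=> dF cf.
have cF : continuous F.
  move=> x; apply/differentiable_continuous/derivable1_diffP.
  exact: (@ex_derive _ _ _ _ _ _ _ (dF x)).
rewrite /Rintegral (@continuous_FTC2 _ _ F)//.
- by apply: continuous_subspaceT.
- split; [|apply: cvg_at_right_filter; exact: cF|apply: cvg_at_left_filter; exact: cF].
  by move=> x _; exact: (@ex_derive _ _ _ _ _ _ _ (dF x)).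
- by move=> x _; rewrite derive1E (@derive_val _ _ _ _ _ _ _ (dF x)).
Qed.

(** The rescaled polynomial [x |-> p.[a * x]] has the primitive
    ['X * mean_poly 1 s], where [s] denotes it. *)
Lemma mean_horner {R : realType} (p : {poly R}) (a : R) :
  mean (horner p) a = (mean_poly 1 p).[a].
Proof.
pose s := \poly_(i < size p) (p`_i * a ^+ i).
have sE x : s.[x] = p.[a * x].
  rewrite horner_poly horner_coef; apply: eq_bigr => i _.
  by rewrite exprMn mulrA.
have -> : mean (horner p) a = \int[lebesgue_measure]_(x in `[0, 1]) s.[x].
  by apply: eq_Rintegral => x _; rewrite sE.
have ds x : is_derive x (1:R) (horner ('X * mean_poly 1 s)) s.[x].
  have -> : s.[x] = (('X * mean_poly 1 s)^`()).[x].
    congr _.[x]; apply/polyP => i; rewrite coef_deriv coefXM /= coef_mean_poly.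
    by rewrite expr1 -(mulr_natr (_ / _)) divfK.
  exact: is_derive_poly.
rewrite (Rintegral01_FTC2 _ _ ds (@continuous_horner _ s)).
rewrite hornerM hornerX mul1r hornerM hornerX mul0r subr0.
have sz q : (size (@mean_poly R 1 q) <= size q)%N by exact: size_poly.
rewrite (horner_coef_wide _ (sz p)).
rewrite (horner_coef_wide _ (leq_trans (sz s) (size_poly _ _))).
apply: eq_bigr => i _; rewrite !coef_mean_poly coef_poly ltn_ord.
by rewrite expr1n mulr1 mulrAC.
Qed.

(** The first integration over the cube produces the reciprocal of the factor
    [ln (1 + t)] that the generating function carries. *)
Lemma mean_expR {R : realType} (a y : R) :
  y * mean (fun b => expR (b * y)) a = expint a y.
Proof.
have [->|y0] := eqVneq y 0; first by rewrite mul0r expint0.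
have dF x : is_derive x (1:R) (fun x => y^-1 * expint a (y * x))
    (expR (a * x * y)).
  have H := is_derive_expint a (y * x).
  have G : is_derive x (1:R) (fun x => y * x) y.
    by apply: is_derive_eq; rewrite /GRing.scale /=; ring.
  have K := @is_derive1_comp _ (expint a) (fun x => y * x) x _ _ H G.
  have K2 : is_derive x (1:R) (fun x => expint a (y * x))
      (expR (a * (y * x)) * y) by [].
  apply: is_derive_eq; rewrite /GRing.scale /= ?mulr0 ?addr0.
  rewrite (_ : a * x * y = a * (y * x)); last ring.
  by field.
have cf : continuous (fun x : R => expR (a * x * y)).
  move=> x; apply: continuous_comp; last exact: continuous_expR.
  by apply: cvgM; [apply: cvgM; [exact: cvg_cst|exact: cvg_id]|exact: cvg_cst].
rewrite /mean (Rintegral01_FTC2 _ _ dF cf) mulr1 mulr0 expint0.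
by field.
Qed.

Definition uniform_poly_approx {R : realType} (A : R) (f : R -> R)
    (p : nat -> {poly R}) (e : nat -> R) :=
  forall n a, `|a| <= A -> `|f a - (p n).[a]| <= e n.

(** The error passes under the integral with no loss, since [0, 1] has measure
    1. The whole sequence of approximations, and not just the one being
    integrated, serves to make [f] measurable as a pointwise limit, hence
    integrable; this spares any continuity argument for iterated means. *)
Lemma mean_approx {R : realType} (A : R) f p e : e @ \oo --> (0:R) ->
  uniform_poly_approx A f p e ->
  uniform_poly_approx A (mean f) (fun n => mean_poly 1 (p n)) e.
Proof.
move=> e0 fp n a aA; rewrite -mean_horner /mean.
pose D := `[0, 1]%classic : set R.
have mD : measurable D by exact: measurable_itv.
have muD : lebesgue_measure D = 1%:E.
  by rewrite lebesgue_measure_itv /= lte_fin ltr01 oppr0 adde0.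
have axA x : D x -> `|a * x| <= A.
  rewrite /D /= in_itv /= => /andP[x0 x1].
  by rewrite normrM (le_trans _ aA)// ler_piMr// ger0_norm.
have cp m : continuous (fun x : R => (p m).[a * x]).
  move=> x; apply: continuous_comp; last exact: continuous_horner.
  by apply: cvgM; [exact: cvg_cst|exact: cvg_id].
have ip m : lebesgue_measure.-integrable D (EFin \o (fun x => (p m).[a * x])).
  apply: continuous_compact_integrable; first exact: segment_compact.
  exact: continuous_subspaceT.
have mfx : measurable_fun D (fun x => f (a * x)).
  apply: (@measurable_realfun.measurable_fun_cvg _ _ _ _ (fun m x => (p m).[a * x])).
    by move=> m; have /integrableP[/measurable_realfun.measurable_EFinP] := ip m.
  move=> x Dx; apply/cvgrPdist_le => eps eps0.
  near=> m; apply: le_trans (fp m _ (axA _ Dx)) _.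
  near: m; exact: (cvgr_le _ e0).
pose err x := f (a * x) - (p n).[a * x].
have ierr : lebesgue_measure.-integrable D (EFin \o err).
  apply: measurable_bounded_integrable => //.
    by rewrite [X in (X < _)%E]muD ltry.
    apply: measurable_realfun.measurable_funB => //.
    by have /integrableP[/measurable_realfun.measurable_EFinP] := ip n.
  exists (e n); split; first exact: num_real.
  by move=> M eM x Dx /=; apply: le_trans (fp n _ (axA _ Dx)) _; exact: ltW.
have ifx : lebesgue_measure.-integrable D (EFin \o (fun x => f (a * x))).
  rewrite (_ : _ \o _ =
      ((EFin \o err) \+ (EFin \o (fun x => (p n).[a * x]%R)))%E).
    exact: integrableD.
  by apply/funext => x /=; rewrite -EFinD subrK.
rewrite -RintegralB//.
apply: le_trans (le_normr_Rintegral _ _) _ => //.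
rewrite (_ : e n = \int[lebesgue_measure]_(x in D) (e n)); last first.
  by rewrite Rintegral_cst// [X in fine X]muD mulr1.
apply: le_Rintegral => //.
- exact: (integrable_norm ierr).
- apply: continuous_compact_integrable; first exact: segment_compact.
  by apply: continuous_subspaceT => x; exact: cvg_cst.
- by move=> x Dx; exact: fp (axA _ Dx).
Unshelve. all: by end_near.
Qed.

Lemma iter_mean_approx {R : realType} (A : R) f p e k : e @ \oo --> (0:R) ->
  uniform_poly_approx A f p e ->
  uniform_poly_approx A (iter k mean f) (fun n => mean_poly k (p n)) e.
Proof.
move=> e0 fp; elim: k => [|k IH] n a aA /=.
  by rewrite mean_poly0; exact: fp.
by rewrite mean_polyS; exact: (mean_approx _ _ _ _ e0 IH).
Qed.

(** The outermost variable [x] multiplies the argument of the inner integral,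
    so the inner integral is a mean taken at [a * x]. *)
Lemma cube_integral_prod {R : realType} k (g : R -> R) (a : R) :
  cube_integral (fun x : k.-tuple R => g (a * \prod_(i < k) tnth x i)) =
  iter k mean g a.
Proof.
elim: k a => [|k IH] a /=; first by rewrite big_ord0 mulr1.
apply: eq_Rintegral => x _; rewrite -IH; congr cube_integral.
apply/funext => s; rewrite big_ord_recr /=.
have -> : tnth [tuple of rcons s x] ord_max = x.
  rewrite (tnth_nth x) /= nth_rcons [in (k < _)%N]size_tuple ltnn.
  by rewrite [in k == _]size_tuple eqxx.
rewrite -mulrA [x * _]mulrC; congr (g (a * (_ * x))); apply: eq_bigr => i _.
by rewrite !(tnth_nth x) /= nth_rcons [in (i < _)%N]size_tuple ltn_ord.
Qed.

(** * The generating identity *)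

(** For [`|t| < (`|lambda| + 1)^-1] the binomial series is dominated by a
    geometric series for all [a] with [`|a| <= `|lambda|], and the partial sums
    of the generating series are [ln (1 + t) / t] times the iterated means of
    its partial sums [p N]. *)
Lemma daehee_gf_mean_poly {R : realType} (lambda : R) k :
  daehee_gf lambda k.+1
    (fun n => (mean_poly k (shifted_falling R n)).[lambda] / n.+1%:R).
Proof.
pose A := `|lambda|.
have A0 : 0 < A + 1 by rewrite ltr_wpDl ?normr_ge0.
have small : \forall t \near (0 : R)^', `|t| < (A + 1)^-1.
  apply: (@nbhs_dnbhs _ (0 : R)); apply/nbhs_ballP; exists (A + 1)^-1 => /=.
    by rewrite invr_gt0.
  by move=> t; rewrite /ball /= sub0r normrN.
have neq0 : \forall t \near (0 : R)^', t != 0 by exact: nbhs_dnbhs_neq.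
near=> t.
have t0 : t != 0 by near: t.
have rt : (A + 1) * `|t| < 1.
  by rewrite mulrC -ltr_pdivlMr// div1r; near: t.
have t1 : `|t| < 1.
  by apply: le_lt_trans rt; rewrite ler_peMl// lerDr normr_ge0.
have tp : 0 < 1 + t by have := lerNnormlW (lexx `|t|); lra.
pose L := ln (1 + t).
have L0 : L != 0.
  apply: contra t0 => /eqP L0; have : expR L = 1 by rewrite L0 expR0.
  rewrite lnK ?posrE// => /eqP; rewrite -subr_eq0 addrC addKr.
  by [].
pose g a := expR (a * L).
rewrite (_ : (fun x => _) = (fun x : k.+1.-tuple R =>
    g (lambda * \prod_(i < k.+1) tnth x i))); last first.
  by apply/funext => x; rewrite /powR gt_eqF.
rewrite cube_integral_prod iterSr.
pose p N : {poly R} :=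
  \sum_(n < N) (L^-1 * (t ^+ n.+1 / n.+1`!%:R)) *: shifted_falling R n.
pose e N := `|L|^-1 *
  (expR (A * `|L|) ^+ 2 * (`|t| / (1 - `|t|)) * ((A + 1) * `|t|) ^+ N).
have e0 : e @ \oo --> (0 : R).
  rewrite -(mulr0 `|L|^-1); apply: cvgMr.
  apply: cvg_geometric; rewrite ger0_norm// mulr_ge0// ltW//.
have base : uniform_poly_approx A (mean g) p e.
  move=> N a aA.
  have -> : mean g a = L^-1 * expint a L by rewrite -mean_expR mulKf.
  have -> : (p N).[a] = L^-1 * (newton_partial a N).[t].
    rewrite !horner_sum mulr_sumr; apply: eq_bigr => n _.
    by rewrite !hornerZ hornerXn; ring.
  rewrite -mulrBr normrM normfV; apply: ler_wpM2l; first by rewrite invr_ge0.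
  exact: newton_partial_bound.
have approx N := iter_mean_approx _ _ _ _ k e0 base N _ (lexx A).
rewrite (_ : series _ =
    fun N => L / t * (mean_poly k (p N)).[lambda]); last first.
  apply/funext => N; rewrite /series /= big_mkord /p mean_poly_sum.
  rewrite horner_sum mulr_sumr; apply: eq_bigr => n _; rewrite mean_polyZ hornerZ factS natrM exprS.
  have f0 : n`!%:R != 0 :> R by rewrite pnatr_eq0 -lt0n fact_gt0.
  have n0 : n%:R + 1 != 0 :> R by rewrite natr1 pnatr_eq0.
  by rewrite -natr1; field; rewrite f0 n0 L0 t0.
apply: cvgMr; apply/cvgrPdist_le => eps eps0.
near=> N; apply: le_trans (approx N) _.
near: N; exact: (cvgr_le _ e0).
Unshelve. all: by end_near.
Qed.

Lemma daehee_gf_inj {R : realType} (lambda : R) k (D D' : nat -> R) :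
  daehee_gf lambda k D -> daehee_gf lambda k D' -> D = D'.
Proof.
move=> HD HD'; apply/funext => n.
suff /(_ n)/eqP : forall n, (D n - D' n) / n`!%:R = 0.
  rewrite mulf_eq0 invr_eq0 pnatr_eq0 -[_ == 0%N]negbK -lt0n fact_gt0 orbF.
  by rewrite subr_eq0 => /eqP.
apply: pseries_eq0; near=> t.
rewrite (_ : series _ = series (fun n => D n * (t ^+ n / n`!%:R)) \-
    series (fun n => D' n * (t ^+ n / n`!%:R))); last first.
  apply/funext => N; rewrite /series /= -sumrB; apply: eq_bigr => i _.
  by rewrite mulrAC -mulrA mulrBl.
rewrite -[0 : R](subrr (ln (1 + t) / t * cube_integral (fun x : k.-tuple R =>
        (1 + t) `^ (lambda * \prod_(i < k) tnth x i)))).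
apply: cvgB; near: t; [exact: HD|exact: HD'].
Unshelve. all: by end_near.
Qed.

(** * The explicit formula *)

Theorem theorem2p5 (R : realType) (lambda : R) (k : nat) (hk : (1 <= k)%N)
    (n : nat) :
  daehee lambda k n =
  1 / (n.+1)%:R *
  \sum_(1 <= m < n.+2)
    lambda ^+ (m - 1) / (m%:R) ^+ (k - 1) * stirling1 R n.+1 m.
Proof.
case: k hk => // k _.
have gf := daehee_gf_mean_poly lambda k.
rewrite /daehee (xget_unique _ gf); last first.
  by move=> D HD; exact: daehee_gf_inj HD gf.
rewrite mulrC div1r; congr (_ * _).
rewrite big_add1 /= big_mkord subn1 /=.
have sz : (size (mean_poly k (shifted_falling R n)) <= n.+1)%N.
  by rewrite -(size_shifted_falling R n); exact: size_poly.
rewrite (horner_coef_wide _ sz); apply: eq_bigr => i _.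
rewrite coef_mean_poly subn1 /= /stirling1 falling_polyS coefXM /=.
by rewrite mulrC mulrA mulrAC.
Qed.
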